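(* Let $\mu$ be the centered Laplace distribution with variance $1$, i.e. $d\mu(x)=\frac{1}{\sqrt2}\exp(-\sqrt2\,|x|)\,dx$ on $\mathbb{R}$. There exist a universal constant $c>0$ and an integer $n_0$ such that, for every $n\ge n_0$ and every origin-symmetric set $T_n\subset\mathbb{R}^n$ satisfying $\{-1,1\}^n\subset T_n\subset(2\mathbb{Z}+1)^n$, if $X\sim\mu^{\otimes n}$, then $$\frac{\widetilde{w}_X(T_n)}{r_X(T_n)}\ge c\,n^{1/4},$$ where $\widetilde{w}_X(T_n)$ is the focused $X$-width of $T_n$ and $r_X(T_n)$ is the detectability radius of $T_n$ with respect to $X$.
   Context: A set $S\subset\mathbb{R}^n$ is origin-symmetric if $S=-S$. $2\mathbb{Z}+1$ is the set of odd integers. $\mu^{\otimes n}$ is the $n$-fold product measure. For $A,T\subset\mathbb{R}^n$ and $r>0$, $A-rT:=\{x-rt: x\in A,\ t\in T\}$. Let $X$ be a random vector in $\mathbb{R}^n$ and $T\subset\mathbb{R}^n$. Detectability radius with respect to $X$: $$r_X(T):=\sup\{r>0:\ \text{there is no measurable } A\subset\mathbb{R}^n \text{ with } \mathbb{P}\{X\in A\}\ge 0.9 \text{ and } \mathbb{P}\{X\in A-rT\}\le 0.1\}.$$ Focused $X$-width: for $S\subset\mathbb{R}^n$ let $w_X(S):=\mathbb{E}\sup_{u\in S}\langle X,u\rangle$ (possibly $+\infty$), and $$\widetilde{w}_X(T):=\inf_S w_X(S),$$ where the infimum is over all origin-symmetric sets $S\subset\mathbb{R}^n$ such that for every $t\in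 T$ there exists $u\in S$ with $\langle t,u\rangle\ge 1$. *)

(* Defs.v *)
From HB Require Import structures.
From mathcomp Require Import all_boot all_order all_algebra.
From mathcomp Require Import all_classical all_reals all_analysis measurable_realfun.

Set Implicit Arguments.
Unset Strict Implicit.
Unset Printing Implicit Defensive.

Import Order.TTheory GRing.Theory Num.Theory.
Import numFieldNormedType.Exports.

Local Open Scope classical_set_scope.
Local Open Scope ring_scope.

Section laplace.
Context {R : realType}.
Local Notation mu := (@lebesgue_measure R).

Definition laplace_pdf (x : R) : R :=
  (Num.sqrt 2)^-1 * expR (- (Num.sqrt 2 * `|x|)).

Lemma laplace_pdf_ge0 x : 0 <= laplace_pdf x.
Proof. by rewrite mulr_ge0 ?expR_ge0// invr_ge0 sqrtr_ge0. Qed.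

Lemma continuous_laplace_pdf : continuous laplace_pdf.
Proof.
move=> x; apply: cvgMr; apply: continuous_cvg; first exact: continuous_expR.
by apply: cvgN; apply: cvgMr; exact: norm_continuous.
Qed.

Lemma measurable_laplace_pdf : measurable_fun [set: R] laplace_pdf.
Proof. by apply: continuous_measurable_fun; exact: continuous_laplace_pdf. Qed.

Lemma integral_laplace_pdf : (\int[mu]_x (laplace_pdf x)%:E = 1)%E.
Proof.
have s0 : 0 < Num.sqrt 2 :> R by rewrite sqrtr_gt0.
have s2 : Num.sqrt 2 * Num.sqrt 2 = 2 :> R by rewrite -expr2 sqr_sqrtr.
rewrite ge0_symfun_integralT//; last 3 first.
- exact: laplace_pdf_ge0.
- exact: continuous_laplace_pdf.
- by move=> x /=; rewrite /laplace_pdf normrN.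
have mposnums : measurable [set x : R | 0 <= x] by rewrite -set_itvcy.
rewrite -ge0_integralZl//=; last 2 first.
- apply: measurable_funTS; apply/measurable_EFinP.
  exact: measurable_laplace_pdf.
- by move=> x _; rewrite lee_fin laplace_pdf_ge0.
rewrite -(integral_exponential_pdf s0) [LHS]integral_mkcond.
apply: eq_integral => x _; rewrite /exponential_pdf !patchE -set_itvcy.
case: ifPn => //; rewrite inE/= in_itv/= andbT => x0.
rewrite /laplace_pdf ger0_norm// -EFinM mulrA mulNr; congr (_ * _)%:E.
by rewrite -[X in X / _]s2 mulfK// gt_eqF.
Qed.

Definition laplace_prob (V : set R) : \bar R :=
  (\int[mu]_(x in V) (laplace_pdf x)%:E)%E.

Let laplace0 : laplace_prob set0 = 0%E.
Proof. by rewrite /laplace_prob integral_set0. Qed.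

Let laplace_ge0 A : (0 <= laplace_prob A)%E.
Proof. by apply: integral_ge0 => x _; rewrite lee_fin laplace_pdf_ge0. Qed.

Let laplace_sigma_additive : semi_sigma_additive laplace_prob.
Proof.
move=> /= F mF tF mUF; rewrite /laplace_prob; apply: cvg_toP.
  apply: ereal_nondecreasing_is_cvgn => m n mn.
  by apply: lee_sum_nneg_natr => // k _ _; exact: laplace_ge0.
rewrite ge0_integral_bigcup//=.
- apply/measurable_funTS/measurableT_comp => //.
  exact: measurable_laplace_pdf.
- by move=> x _; rewrite lee_fin laplace_pdf_ge0.
Qed.

HB.instance Definition _ := isMeasure.Build _ _ _
  laplace_prob laplace0 laplace_ge0 laplace_sigma_additive.

Let laplace_setT : laplace_prob [set: R] = 1%E.
Proof. exact: integral_laplace_pdf. Qed.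

HB.instance Definition _ :=
  @Measure_isProbability.Build _ _ R laplace_prob laplace_setT.

End laplace.

Section product_probability.
Context d (T : measurableType d) (R : realType).

Definition cons_pair n (p : T * n.-tuple T) : n.+1.-tuple T :=
  [tuple of p.1 :: p.2].

Lemma measurable_cons_pair n :
  measurable_fun [set: T * n.-tuple T] (@cons_pair n).
Proof. exact: measurable_cons. Qed.

HB.instance Definition _ n :=
  isMeasurableFun.Build _ _ _ _ (@cons_pair n) (@measurable_cons_pair n).

Variable P : probability T R.

(* The n-fold product measure, obtained by iterating the binary product;
   [product_probability_box] gives its characterization on boxes. *)
Fixpoint product_probability n : probability (n.-tuple T) R :=
  match n return probability (n.-tuple T) R with
  | 0 => \d_[tuple]
  | n'.+1 => distribution (P \x product_probability n')%E (@cons_pair n')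
  end.

Lemma product_probability_box n (B : 'I_n -> set T) :
  (forall i, measurable (B i)) ->
  product_probability n [set x | forall i, B i (tnth x i)] =
    (\prod_(i < n) P (B i))%E.
Proof.
elim: n B => [|n IH] B mB /=.
  by rewrite big_ord0 diracE mem_set//= => -[].
rewrite big_ord_recl -IH; last by move=> i; exact: mB.
rewrite -product_measure1E//; last first.
  rewrite [X in measurable X](_ : _ = \bigcap_(i in [set: 'I_n])
     ((fun x : n.-tuple T => tnth x i) @^-1` B (lift ord0 i))); last first.
    by apply/seteqP; split => [x h i _ /=|x h i]; [exact: h|exact: h i I].
  apply: fin_bigcap_measurable => // i _.
  by rewrite -[X in measurable X]setTI; apply: measurable_tnth.
congr (_ _); apply/seteqP; split => -[x y] /=.
  move=> h; split; first exact: (h ord0).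
  by move=> i; have := h (lift ord0 i); rewrite tnthS.
move=> [Bx By] i; case: (unliftP ord0 i) => [j ->|->]; last by [].
by rewrite tnthS; exact: By.
Qed.

End product_probability.

Section vectors.
Context {R : realType} {n : nat}.
Implicit Types (x u t : n.-tuple R) (A S T : set (n.-tuple R)).

Definition dotp x u : R := \sum_(i < n) tnth x i * tnth u i.

Definition vopp x : n.-tuple R := [tuple - tnth x i | i < n].

Definition origin_symmetric S := S = vopp @` S.

Definition minkowski_sub A (r : R) T : set (n.-tuple R) :=
  [set [tuple tnth x i - r * tnth t i | i < n] | x in A & t in T].

Definition sign_vectors : set (n.-tuple R) :=
  [set x | forall i, tnth x i = -1 \/ tnth x i = 1].

Definition odd_vectors : set (n.-tuple R) :=
  [set x | forall i, exists k : int, tnth x i = (2 * k + 1)%:~R].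

End vectors.

Section widths.
Context {R : realType} {n : nat} d (Omega : measurableType d)
  (P : probability Omega R) (X : {RV P >-> n.-tuple R}).
Implicit Types S T : set (n.-tuple R).
Local Open Scope ereal_scope.

(* Equality is required on measurable sets only: the value of a measure on a
   non-measurable set is unspecified. *)
Definition has_law (Q : probability (n.-tuple R) R) :=
  forall A : set (n.-tuple R), measurable A -> distribution P X A = Q A.

(* The set [minkowski_sub A r T] is measurable whenever [T] is countable, being
   then a countable union of translates of [A]. [ereal_sup set0 = -oo] rather
   than 0, but the set below is nonempty when [T] is nonempty and countable and
   [X] has a density, translations being continuous in L1. *)
Definition detectability_radius T : \bar R :=
  ereal_sup [set r%:E | r in [set r : R | (0 < r)%R /\
    ~ exists A : set (n.-tuple R),
        [/\ measurable A,
            (9 / 10)%:E <= P (X @^-1` A) &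
            P (X @^-1` minkowski_sub A r T) <= (1 / 10)%:E]]].

(* The integrand is measurable, as a supremum of linear forms, and nonnegative
   when [S] is nonempty and origin-symmetric. *)
Definition width S : \bar R :=
  \int[P]_w ereal_sup [set (dotp (X w) u)%:E | u in S].

Definition focused_width T : \bar R :=
  ereal_inf [set width S | S in [set S | origin_symmetric S /\
    forall t, T t -> exists2 u, S u & (1 <= dotp t u)%R]].

End widths.

(* Main.v *)
Require Import Defs.
From HB Require Import structures.
From mathcomp Require Import all_boot all_order all_algebra.
From mathcomp Require Import all_classical all_reals all_analysis.
From mathcomp Require Import measurable_realfun ring lra.

Set Implicit Arguments.
Unset Strict Implicit.
Unset Printing Implicit Defensive.

Import Order.TTheory GRing.Theory Num.Theory.
Import numFieldNormedType.Exports.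

Local Open Scope classical_set_scope.
Local Open Scope ring_scope.

(** The focused width is at least a constant, and the detectability radius is
    positive and at most of order n^(-1/4); write s for the square root of 2.

    Width.  For each sign vector t choose u_t in S with <t, u_t> >= 1.  Then
    the supremum of <X, u> over S is at least <X, u_t>, where t is the vector
    of signs of X.  Given the signs, X has mean E|X_1| t, so the expectation of
    this lower bound is E|X_1| = 1/s times an average of numbers <t, u_t> >= 1
    ([integral_dotp_orthant], [focused_width_ge]).

    Radius, from above.  Every t in T has odd coordinates, so subtracting r t
    changes the sign of each cos(pi x_i / r).  The test
    A = {x | sum_i cos(pi x_i / r) >= 0} therefore satisfies
    A - rT = {x | sum_i cos(pi x_i / r) <= 0}, however large T is
    ([minkowski_sub_cos_sum]).  The Laplace law has characteristic function
    d = 2 / (a^2 + 2) at a = pi / r ([integral_laplace_cos]), which decays only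
    quadratically: d is of order r^2 for small r.  The sum has mean n d and
    fluctuations of order n^(1/2), so the test succeeds once n d^2 is large,
    that is, once r exceeds a multiple of n^(-1/4).  The error is estimated by
    Chernoff's method ([laplace_cos_sum_tail]), for which the independence of
    the coordinates enters only through integrals of products of nonnegative
    functions ([integral_product_probability_prod]).

    Radius, from below.  The quotient is meaningful only if the radius is
    positive.  The Laplace density at x - r is at least e^(-s r) times the
    density at x, so a translation by (r, ..., r) decreases the probability of
    an event at most by the factor e^(-s r n).  For r = 1 / (2 s n) no set of
    probability 9/10 can be moved to a set of probability 1/10
    ([product_probability_map_ge], [detectability_radius_gt0]). *)

(** * Integrals over a product of probability measures *)

Section product_probability_theory.
Context d (T : measurableType d) (R : realType) (P : probability T R).
Local Open Scope ereal_scope.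

Lemma measurable_prod_tnth n (f : 'I_n -> T -> R) :
  (forall i, measurable_fun [set: T] (f i)) ->
  measurable_fun [set: n.-tuple T]
    (fun x : n.-tuple T => (\prod_(i < n) f i (tnth x i))%R).
Proof.
move=> mf; apply: measurable_prod => i _.
by apply: measurableT_comp => //; exact: measurable_tnth.
Qed.

(** Independence of the coordinates, for nonnegative functions: Tonelli's theorem
    then applies with no integrability condition. *)
Lemma integral_product_probability_prod n (f : 'I_n -> T -> R) :
  (forall i, measurable_fun [set: T] (f i)) ->
  (forall i x, (0 <= f i x)%R) ->
  \int[product_probability P n]_x (\prod_(i < n) f i (tnth x i))%:E =
  \prod_(i < n) \int[P]_x (f i x)%:E.
Proof.
elim: n f => [|n IH] f mf f0.
  rewrite big_ord0 (eq_integral (cst 1)).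
    by rewrite integral_cst//= diracT mule1.
  by move=> x _; rewrite big_ord0.
have m1 : measurable_fun [set: n.-tuple T]
    (fun y => (\prod_(i < n) f (lift ord0 i) (tnth y i))%:E).
  apply/measurable_EFinP.
  by apply: (measurable_prod_tnth (f := fun i => f (lift ord0 i))).
rewrite /= ge0_integral_distribution; last 2 first.
- by apply/measurable_EFinP; apply: (measurable_prod_tnth (f := f)).
- by move=> x; rewrite lee_fin prodr_ge0.
have mg : measurable_fun [set: T * n.-tuple T]
    (fun p => (f ord0 p.1 * \prod_(i < n) f (lift ord0 i) (tnth p.2 i))%:E).
  apply/measurable_EFinP/measurable_funM.
    by apply: (measurableT_comp (f := f ord0)) => //; exact: mf.
  apply: (measurableT_comp (f := fun y : n.-tuple T =>
    (\prod_(i < n) f (lift ord0 i) (tnth y i))%R)) => //.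
  by apply: (measurable_prod_tnth (f := fun i => f (lift ord0 i))) => i; exact: mf.
rewrite (eq_integral (fun p : T * n.-tuple T => (f ord0 p.1 *
    \prod_(i < n) f (lift ord0 i) (tnth p.2 i))%:E)); last first.
  move=> p _ /=; rewrite big_ord_recl; congr (_ * _)%:E.
  by apply: eq_bigr => i _; rewrite tnthS.
rewrite fubini_tonelli1//; last first.
  by move=> p; rewrite lee_fin mulr_ge0// prodr_ge0.
rewrite big_ord_recl -IH => [|i|i x]; [|exact: mf|exact: f0].
rewrite -ge0_integralZr//; last 3 first.
- exact/measurable_EFinP.
- by move=> x _; rewrite lee_fin.
- by apply: integral_ge0 => x _; rewrite lee_fin prodr_ge0.
apply: eq_integral => x _; rewrite /fubini_F/=.
under eq_integral do rewrite EFinM.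
rewrite ge0_integralZl_EFin// => y _.
by rewrite lee_fin prodr_ge0.
Qed.

Lemma measurable_map_tuple n (phi : T -> T) : measurable_fun [set: T] phi ->
  measurable_fun [set: n.-tuple T] (map_tuple phi).
Proof.
move=> mphi; apply/measurable_fun_tnthP => i.
rewrite (_ : _ \o _ = fun x => phi (tnth x i)); last first.
  by apply/funext => x /=; rewrite tnth_map.
by apply: measurableT_comp => //; exact: measurable_tnth.
Qed.

(** Slice along the first coordinate: the induction hypothesis compares the
    sections, and the hypothesis on [P] compares the integrals of their measures
    over that coordinate. *)
Lemma product_probability_map_ge n (k : R) (phi : T -> T) :
  (0 <= k)%R -> measurable_fun [set: T] phi ->
  (forall B, measurable B -> k%:E * P B <= P (phi @^-1` B)) ->
  forall A : set (n.-tuple T), measurable A ->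
  (k ^+ n)%:E * product_probability P n A <=
  product_probability P n (map_tuple phi @^-1` A).
Proof.
move=> k0 mphi kP; elim: n => [|n IH] A mA.
  rewrite expr0 mul1e (_ : map_tuple phi @^-1` A = A)//.
  by apply/seteqP; split => x; rewrite /preimage/= (tuple0 x) (tuple0 (map_tuple _ _)).
pose Q := product_probability P n.
pose B : set (T * n.-tuple T) := @cons_pair _ _ n @^-1` A.
have mB : measurable B by rewrite -[B]setTI; exact: measurable_cons_pair.
have mphin := @measurable_map_tuple n _ mphi.
have mBphi : measurable ((fun p => (phi p.1, map_tuple phi p.2)) @^-1` B).
  rewrite -[X in measurable X]setTI.
  have mphi2 : measurable_fun [set: T * n.-tuple T]
      (fun p => (phi p.1, map_tuple phi p.2)).
    apply/measurable_fun_pair => /=.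
      by apply: (measurableT_comp (f := phi)).
    by apply: (measurableT_comp (f := map_tuple phi)).
  exact: mphi2.
have xsectionE x : xsection ((fun p => (phi p.1, map_tuple phi p.2)) @^-1` B) x =
    map_tuple phi @^-1` xsection B (phi x).
  by apply/seteqP; split => y; rewrite /xsection/= !inE.
have -> : product_probability P n.+1 A = \int[P]_x Q (xsection B x) by [].
have -> : product_probability P n.+1 (map_tuple phi @^-1` A) =
    \int[P]_x Q (map_tuple phi @^-1` xsection B (phi x)).
  transitivity ((P \x Q)
      ((fun p => (phi p.1, map_tuple phi p.2)) @^-1` B)).
    rewrite [LHS](_ : _ =
      (P \x Q) (@cons_pair _ _ n @^-1` (map_tuple phi @^-1` A)))//.
    congr ((P \x Q)%E _); apply/funext => -[x y].
    by rewrite /preimage/= /B/= /cons_pair/=; congr A; apply: val_inj.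
  by apply: eq_integral => x _ /=; rewrite xsectionE.
have mQB : measurable_fun [set: T] (Q \o xsection B).
  exact: measurable_fun_xsection.
have kP' C : measurable C -> mscale (NngNum k0) P C <= pushforward P phi C.
  exact: kP.
apply: (@le_trans _ _ ((k ^+ n)%:E * \int[P]_x (Q \o xsection B) (phi x))).
  rewrite exprSr EFinM -muleA lee_wpmul2l ?lee_fin ?exprn_ge0//.
  rewrite -(ge0_integral_mscale _ _ (NngNum k0))//.
  rewrite -[leRHS](ge0_integral_pushforward mphi _ (D := setT) (f := Q \o xsection B))//.
  exact: ge0_le_measure_integral.
rewrite -ge0_integralZl_EFin ?exprn_ge0//; last first.
  exact: (measurableT_comp (f := Q \o xsection B)).
apply: ge0_le_integral => //.
- by move=> x _; rewrite mule_ge0// lee_fin exprn_ge0.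
- apply: emeasurable_funM => //.
  exact: (measurableT_comp (f := Q \o xsection B)).
- rewrite [X in measurable_fun _ X](_ : _ = Q \o xsection
      ((fun p => (phi p.1, map_tuple phi p.2)) @^-1` B)).
    exact: measurable_fun_xsection.
  by apply/funext => x /=; rewrite xsectionE.
- by move=> x _; apply: IH; exact: measurable_xsection.
Qed.
End product_probability_theory.

(** * Lebesgue measure and the Laplace law *)

Section laplace_theory.
Context {R : realType}.
Local Notation mu := (@lebesgue_measure R).
Local Notation P := (@laplace_prob R).
Local Notation s := (Num.sqrt 2 : R).

Import HBNNSimple.

(** The two sides agree on indicators by the definition of the law, hence on simple
    functions, hence in the monotone limit. *)
Lemma ge0_integral_laplace (f : R -> \bar R) :
  measurable_fun [set: R] f -> (forall x, (0 <= f x)%E) ->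
  (\int[P]_x f x = \int[mu]_x (f x * (laplace_pdf x)%:E))%E.
Proof.
move=> mf f0; pose h := nnsfun_approx measurableT mf.
have mp : measurable_fun [set: R] (fun x : R => (laplace_pdf x)%:E).
  by apply/measurable_EFinP; exact: measurable_laplace_pdf.
have p0 x : (0 <= (laplace_pdf x : R)%:E)%E by rewrite lee_fin laplace_pdf_ge0.
have mh n : measurable_fun [set: R] (fun x => (h n x)%:E) by exact/measurable_EFinP.
have hf x : (h n x)%:E @[n --> \oo] --> f x by exact: cvg_nnsfun_approx.
have hnd x : {homo (fun n => h n x) : m n / (m <= n)%N >-> m <= n}.
  by move=> m n mn; exact/lefP/nd_nnsfun_approx.
transitivity (lim ((\int[P]_x (h n x)%:E)%E @[n --> \oo])).
  rewrite -monotone_convergence//.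
  - by apply: eq_integral => x _; apply/esym/cvg_lim => //; exact: hf.
  - by move=> n x _; rewrite lee_fin.
  - by move=> x _ m n mn; rewrite lee_fin hnd.
transitivity (lim ((\int[mu]_x ((h n x)%:E * (laplace_pdf x)%:E))%E
    @[n --> \oo])); last first.
  rewrite -monotone_convergence//.
  - apply: eq_integral => x _; apply/cvg_lim => //.
    by apply: cvgeZr => //; exact: hf.
  - by move=> n; apply: emeasurable_funM; [exact: mh|exact: mp].
  - by move=> n x _; rewrite mule_ge0// lee_fin.
  - by move=> x _ m n mn; rewrite lee_wpmul2r// lee_fin hnd.
suff E n : (\int[P]_x (h n x)%:E = \int[mu]_x ((h n x)%:E * (laplace_pdf x)%:E))%E.
  by under eq_fun do rewrite E.
under eq_integral do rewrite fimfunE -fsumEFin//.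
have mhy y : measurable_fun [set: R] (fun x => (y * \1_(h n @^-1` [set y]) x)%:E).
  exact/measurable_EFinP/measurable_funM.
rewrite ge0_integral_fsum//; last first.
  by move=> y x _; exact: nnfun_muleindic_ge0.
under [RHS]eq_integral => x _.
  rewrite fimfunE -fsumEFin// ge0_mule_fsuml; last first.
    by move=> y; exact: nnfun_muleindic_ge0.
  over.
rewrite ge0_integral_fsum//; last 2 first.
- move=> y; apply: emeasurable_funM; last exact: mp.
  exact: (mhy y).
- by move=> y x _; rewrite mule_ge0//; exact: nnfun_muleindic_ge0.
apply: eq_fsbigr => y _.
rewrite integralZl_indic_nnsfun// integral_indic// setIT.
have [y0|y0] := ltP y 0.
  rewrite preimage_nnfun0// measure0 mule0 integral0_eq// => x _.
  by rewrite indic0 mulr0 mul0e.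
under [RHS]eq_integral do rewrite EFinM -muleA.
rewrite ge0_integralZl_EFin//; last 2 first.
- by move=> x _; rewrite mule_ge0// lee_fin.
- apply: emeasurable_funM; last exact: mp.
  have : measurable_fun [set: R] (fun x : R => (\1_(h n @^-1` [set y]) x : R)%:E).
    exact/measurable_EFinP.
  exact.
congr (_ * _)%E; rewrite /laplace_prob [LHS]integral_mkcond.
by apply: eq_integral => x _; rewrite epatch_indic/= muleC.
Qed.

Lemma ge0_integral_lebesgueN (f : R -> \bar R) :
  measurable_fun [set: R] f -> (forall x, (0 <= f x)%E) ->
  (\int[mu]_x f x = \int[mu]_x f (- (x : R))%R)%E.
Proof.
move=> mf f0.
have mN : measurable_fun [set: measurableTypeR R] (-%R : R -> measurableTypeR R).
  exact: (@oppr_measurable R setT).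
rewrite -[RHS](ge0_integral_pushforward mN mu (D := setT) (f := f))//.
by apply: eq_measure_integral => A mA _; exact/esym/lebesgue_measureN.
Qed.

Lemma lebesgue_measureD (r : R) (A : set R) : measurable A ->
  pushforward mu (fun x : R => x + r : measurableTypeR R) A = mu A.
Proof.
have mD : measurable_fun [set: measurableTypeR R]
    (fun x : measurableTypeR R => (x + r : R) : measurableTypeR R).
  exact: (@measurable_funD _ _ R setT (fun x => x) (cst r)).
pose phi : {mfun measurableTypeR R >-> measurableTypeR R} :=
  HB.pack (fun x : measurableTypeR R => (x + r : R) : measurableTypeR R)
    (isMeasurableFun.Build _ _ _ _ _ mD).
move=> mA; apply/esym.
apply: (@lebesgue_measure_unique _ (pushforward mu phi)) => //= _ [[a b]] _ <-.
rewrite /pushforward /phi/= (_ : _ @^-1` _ = `]a - r, b - r]%classic).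
  rewrite !lebesgue_measure_itv/= !lte_fin ltrD2r.
  by rewrite -!EFinB opprB addrA subrK.
by apply/seteqP; split => x /=; rewrite !in_itv/= ltrBlDr lerBrDr.
Qed.

Lemma ge0_integral_lebesgueD (r : R) (f : R -> \bar R) :
  measurable_fun [set: R] f -> (forall x, (0 <= f x)%E) ->
  (\int[mu]_x f x = \int[mu]_x f ((x : R) + r)%R)%E.
Proof.
move=> mf f0.
have mD : measurable_fun [set: measurableTypeR R]
    (fun x : measurableTypeR R => (x + r : R) : measurableTypeR R).
  exact: (@measurable_funD _ _ R setT (fun x => x) (cst r)).
rewrite -[RHS](ge0_integral_pushforward mD mu (D := setT) (f := f))//.
by apply: eq_measure_integral => A mA _; exact/esym/lebesgue_measureD.
Qed.

Lemma measurable_indic_sign b :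
  measurable_fun [set: R] (fun x : R => ((x < 0) == b)%:R : R).
Proof.
rewrite (_ : (fun x : R => _) =
    \1_(if b then `]-oo, 0[%classic else `[0, +oo[%classic)).
  by apply: measurable_indic; case: b.
apply/funext => x; rewrite indicE; congr (_%:R); apply/esym.
by case: b; rewrite mem_setE in_itv/= ?andbT ?leNgt; case: (x < 0).
Qed.

(** Reflection preserves [f], the density and Lebesgue measure, and the point 0 is
    negligible: both half-lines contribute the same integral. *)
Lemma integral_laplace_half (b : bool) (f : R -> R) :
  measurable_fun [set: R] f -> (forall x, 0 <= f x) -> f =1 f \o -%R ->
  (\int[P]_x (((x < 0) == b)%:R * f x)%:E =
   \int[mu]_(x in `[0%R, +oo[) (f x * laplace_pdf x)%:E)%E.
Proof.
move=> mf f0 fN.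
have mfp : measurable_fun [set: R] (fun x => (f x * laplace_pdf x)%:E).
  by apply/measurable_EFinP/measurable_funM => //; exact: measurable_laplace_pdf.
have mg : measurable_fun [set: R] (fun x => (((x < 0) == b)%:R * f x)%:E).
  by apply/measurable_EFinP/measurable_funM => //; exact: measurable_indic_sign.
rewrite ge0_integral_laplace//; last by move=> x; rewrite lee_fin mulr_ge0.
case: b mg => mg.
  rewrite ge0_integral_lebesgueN; last 2 first.
  - apply: emeasurable_funM => //; apply/measurable_EFinP.
    exact: measurable_laplace_pdf.
  - by move=> x; rewrite mule_ge0// lee_fin ?laplace_pdf_ge0// mulr_ge0.
  rewrite -integral_itv_obnd_cbnd; last first.
    by apply: measurable_funTS; exact: mfp.
  rewrite [RHS]integral_mkcond; apply: eq_integral => x _.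
  rewrite patchE mem_setE in_itv/= andbT oppr_lt0.
  have -> : f (- x) = f x by rewrite [RHS]fN.
  case: (0 < x); rewrite ?mul0r ?mul0e// mul1r -EFinM.
  by rewrite /laplace_pdf normrN.
rewrite [RHS]integral_mkcond; apply: eq_integral => x _.
rewrite patchE mem_setE in_itv/= andbT leNgt.
by case: (x < 0); rewrite ?mul0r ?mul0e// mul1r -EFinM.
Qed.

Lemma sqrt2_gt0 : 0 < s. Proof. by rewrite sqrtr_gt0. Qed.

Lemma sqrt2_sqr : s * s = 2.
Proof. by rewrite -expr2 sqr_sqrtr. Qed.

Lemma sqrt2V : s^-1 = s / 2.
Proof.
have s0 : s != 0 by rewrite gt_eqF ?sqrt2_gt0.
by apply: (mulfI s0); rewrite mulrA sqrt2_sqr !divff.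
Qed.

Lemma sqrt2_ge1 : 1 <= s.
Proof. by rewrite -[X in X <= _]sqrtr1 ler_wsqrtr// ler1n. Qed.

Lemma sqrt2_le2 : s <= 2.
Proof. by have := sqrt2_sqr; have := sqrt2_ge1; nra. Qed.

Lemma integral_laplace_even (f : R -> R) :
  measurable_fun [set: R] f -> (forall x, 0 <= f x) -> f =1 f \o -%R ->
  (\int[P]_x (f x)%:E =
   2%:E * \int[mu]_(x in `[0%R, +oo[) (f x * laplace_pdf x)%:E)%E.
Proof.
move=> mf f0 fN.
rewrite (eq_integral (fun x : R => (((x < 0) == true)%:R * f x)%:E +
   (((x < 0) == false)%:R * f x)%:E)%E).
  rewrite ge0_integralD//; last 4 first.
  - by move=> x _; rewrite lee_fin mulr_ge0.
  - by apply/measurable_EFinP/measurable_funM => //; exact: measurable_indic_sign.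
  - by move=> x _; rewrite lee_fin mulr_ge0.
  - by apply/measurable_EFinP/measurable_funM => //; exact: measurable_indic_sign.
  by rewrite !integral_laplace_half// mule_natl mule2n.
by move=> x _; rewrite -EFinD -mulrDl; case: (x < 0); rewrite /= ?addr0 ?add0r mul1r.
Qed.

Lemma cvg_expR_affine (k : R -> R) (c : R) :
  (forall x, 0 <= x -> `|k x| <= c * (1 + x)) ->
  (fun x => expR (- (s * x)) * k x) x @[x --> +oo] --> 0.
Proof.
move=> kc.
have e0 : c * 2 * expR (- (2^-1 * x)) @[x --> +oo] --> (0 : R).
  rewrite -[X in _ --> X](mulr0 (c * 2)); apply: cvgMl_tmp.
  apply: (@cvg_comp _ _ _ (fun x : R => 2^-1 * x) (fun z => expR (- z))
    _ (pinfty_nbhs R)).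
    exact: gt0_cvgMry.
  exact: cvgr_expR.
apply/norm_cvg0P.
apply: (squeeze_cvgr (f := cst 0) _ (cvg_cst 0) e0); near=> x.
have x0 : 0 <= x by near: x; exact: nbhs_pinfty_ge.
rewrite /= normr_ge0/= normrM (ger0_norm (expR_ge0 _)).
have c0 : 0 <= c.
  by have := le_trans (normr_ge0 _) (kc 0 (lexx _)); rewrite addr0 mulr1.
apply: (@le_trans _ _ (expR (- x) * (c * (2 * expR (2^-1 * x))))).
  apply: ler_pM => //.
    by rewrite ler_expR lerN2 ler_peMl// sqrt2_ge1.
  apply: (le_trans (kc _ x0)); rewrite ler_wpM2l//.
  by have := expR_ge1Dx (2^-1 * x); lra.
(* half of the exponential decay absorbs the factor 1 + x <= 2 exp(x / 2) *)
rewrite (_ : - x = - (2^-1 * x) - 2^-1 * x); last by lra.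
rewrite expRB expRN le_eqVlt; apply/orP; left; apply/eqP; field.
by rewrite expR_eq0.
Unshelve. all: by end_near. Qed.

(** The equation k' = s k + h / s makes exp(- s x) k(x) a primitive of [h] times the
    density on the positive half-line, and the growth condition makes this
    primitive vanish at infinity.  Each integral below is thus reduced to solving
    that equation. *)
Lemma integral_laplace_FTC (h k : R -> R) (c : R) :
  continuous h -> (forall x, 0 <= x -> 0 <= h x) ->
  (forall x : R, is_derive x 1 k (s * k x + s^-1 * h x)) ->
  (forall x, 0 <= x -> `|k x| <= c * (1 + x)) ->
  (\int[mu]_(x in `[0%R, +oo[) (h x * laplace_pdf x)%:E = (- k 0)%:E)%E.
Proof.
move=> ch h0 dk kc.
have dF (x : R) : is_derive x 1 (fun x => expR (- (s * x)) * k x)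
   (s^-1 * expR (- (s * x)) * h x).
  by apply: is_derive_eq; rewrite /GRing.scale/=; ring.
have cF : continuous (fun x : R => expR (- (s * x)) * k x).
  move=> x; apply: differentiable_continuous; apply/derivable1_diffP.
  by have [] := dF x.
rewrite (@ge0_continuous_FTC2y _ _ (fun x => expR (- (s * x)) * k x) _ 0).
- by rewrite mulr0 oppr0 expR0 mul1r sub0e.
- by move=> x x0; rewrite mulr_ge0 ?h0 ?laplace_pdf_ge0.
- apply: continuous_subspaceT => x; apply: continuousM; first exact: ch.
  exact: continuous_laplace_pdf.
- exact: cvg_expR_affine kc.
- by move=> x _; have [] := dF x.
- exact/cvg_at_right_filter/cF.
- move=> x; rewrite in_itv/= andbT => x0.
  rewrite derive1E; have [_ ->] := dF x.
  by rewrite /laplace_pdf ger0_norm ?ltW// mulrC.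
Qed.

Lemma integral_laplace_pdf_half :
  (\int[mu]_(x in `[0%R, +oo[) (laplace_pdf x)%:E = (2^-1)%:E)%E.
Proof.
under eq_integral do rewrite -[laplace_pdf _]mul1r.
have dk (x : R) : is_derive x 1 (fun=> - 2^-1 : R) (s * - 2^-1 + s^-1 * 1).
  by apply: is_derive_eq; rewrite sqrt2V; ring.
rewrite (@integral_laplace_FTC (cst 1) (fun=> - 2^-1) 1 _ _ dk) ?opprK//=.
- by move=> x; exact: cvg_cst.
- by move=> x x0; rewrite normrN ger0_norm; lra.
Qed.

Lemma integral_laplace_norm_half :
  (\int[mu]_(x in `[0%R, +oo[) (`|x| * laplace_pdf x)%:E = ((2 * s)^-1)%:E)%E.
Proof.
transitivity (\int[mu]_(x in `[0%R, +oo[) (x * laplace_pdf x)%:E)%E.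
  by apply: eq_integral => x; rewrite inE/= in_itv/= andbT => x0; rewrite ger0_norm.
have s0 := gt_eqF sqrt2_gt0.
have dk (x : R) : is_derive x 1 (fun x => - (x / 2 + (2 * s)^-1))
    (s * (- (x / 2 + (2 * s)^-1)) + s^-1 * x).
  by apply: is_derive_eq; rewrite /GRing.scale/= invfM sqrt2V; field: sqrt2_sqr.
rewrite (@integral_laplace_FTC id (fun x => - (x / 2 + (2 * s)^-1)) 1 _ _ dk) ?opprK//=.
- by rewrite mul0r add0r.
- by move=> x; exact: cvg_id.
- move=> x x0; have := sqrt2_le2; have := sqrt2_gt0.
  rewrite invfM sqrt2V normrN => ? ?; rewrite ger0_norm; lra.
Qed.

(** The summand 1 keeps the integrand nonnegative on the half-line; the other summand
    of the value is the characteristic function of the Laplace law at [a]. *)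
Lemma integral_laplace_cos (a : R) :
  (\int[P]_x (1 + cos (a * x))%:E = (1 + 2 / (a ^+ 2 + 2))%:E)%E.
Proof.
have cc : continuous (fun x => 1 + cos (a * x)).
  move=> x; apply: cvgD; first exact: cvg_cst.
  apply: continuous_comp; last exact: continuous_cos.
  by apply: cvgMl_tmp; exact: cvg_id.
rewrite integral_laplace_even; last 3 first.
- exact: continuous_measurable_fun.
- by move=> x; have := cos_geN1 (a * x); lra.
- by move=> x; rewrite /= mulrN cosN.
have s0 := gt_eqF sqrt2_gt0.
have D0 : a ^+ 2 + 2 != 0 by rewrite gt_eqF// ltr_wpDl// sqr_ge0.
pose k x := - 2^-1 + s^-1 * (a * sin (a * x) - s * cos (a * x)) / (a ^+ 2 + 2).
have dk (x : R) : is_derive x 1 k (s * k x + s^-1 * (1 + cos (a * x))).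
  by rewrite /k; apply: is_derive_eq; rewrite /GRing.scale/= sqrt2V; field: sqrt2_sqr.
rewrite (@integral_laplace_FTC _ k (2^-1 + s^-1 * (`|a| + s) / (a ^+ 2 + 2)) cc _ dk).
- rewrite /k mulr0 sin0 cos0 -EFinM; congr EFin; field.
  by rewrite D0 s0.
- by move=> x _; have := cos_geN1 (a * x); lra.
- move=> x x0; rewrite /k -[leLHS]mulr1; apply: ler_pM => //; last by rewrite lerDl.
  rewrite (le_trans (ler_normD _ _))// normrN ger0_norm ?lerD2l ?invr_ge0//.
  have Dge0 : 0 <= a ^+ 2 + 2 by rewrite addr_ge0 ?sqr_ge0.
  rewrite !normrM !normfV (gtr0_norm sqrt2_gt0) (ger0_norm Dge0).
  rewrite ler_wpM2r ?invr_ge0// ler_wpM2l ?invr_ge0//.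
  rewrite (le_trans (ler_normB _ _))// !normrM (gtr0_norm sqrt2_gt0).
  by rewrite lerD// ler_piMr ?sin_max ?cos_max.
Qed.

(** The logarithm of the density is Lipschitz with constant s. *)
Lemma laplace_shift_ge (r : R) (B : set R) : 0 <= r -> measurable B ->
  ((expR (- (s * r)))%:E * P B <= P ((fun x => x + r)%R @^-1` B))%E.
Proof.
move=> r0 mB.
have mI A : measurable A -> measurable_fun [set: R] (fun x => (\1_A x : R)%:E).
  by move=> mA; exact/measurable_EFinP/measurable_indic.
have mBr : measurable ((fun x => x + r) @^-1` B).
  rewrite -[X in measurable X]setTI.
  have : measurable_fun [set: R] (fun x : R => x + r) by exact: measurable_funD.
  exact.
have PI A : measurable A -> P A = (\int[mu]_x ((\1_A x)%:E * (laplace_pdf x)%:E))%E.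
  move=> mA; rewrite -ge0_integral_laplace//; last exact: mI.
  by rewrite integral_indic// setIT.
have mp : measurable_fun [set: R] (fun x : R => (laplace_pdf x)%:E).
  by apply/measurable_EFinP; exact: measurable_laplace_pdf.
have mpr : measurable_fun [set: R] (fun x : R => (laplace_pdf (x - r))%:E).
  apply/measurable_EFinP; apply: (measurableT_comp (f := laplace_pdf)).
    exact: measurable_laplace_pdf.
  exact: measurable_funB.
rewrite !PI// [leRHS](_ : _ = \int[mu]_x ((\1_B x)%:E * (laplace_pdf (x - r))%:E))%E.
  rewrite -ge0_integralZl_EFin ?expR_ge0//; last 2 first.
  - by move=> x _; rewrite mule_ge0// lee_fin laplace_pdf_ge0.
  - by apply: emeasurable_funM; [exact: mI|exact: mp].
  apply: ge0_le_integral => //.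
  - by move=> x _; rewrite !mule_ge0// lee_fin ?expR_ge0// laplace_pdf_ge0.
  - by apply: emeasurable_funM => //; apply: emeasurable_funM; [exact: mI|exact: mp].
  - by apply: emeasurable_funM; [exact: mI|exact: mpr].
  move=> x _; rewrite muleCA lee_wpmul2l// ?lee_fin//.
  rewrite /laplace_pdf mulrCA ler_wpM2l ?invr_ge0// -expRD ler_expR.
  rewrite -opprD lerN2 -mulrDr ler_wpM2l//.
  by rewrite (le_trans (ler_normB _ _))// addrC (ger0_norm r0).
rewrite [RHS](ge0_integral_lebesgueD r); last 2 first.
- by apply: emeasurable_funM; [exact: mI|exact: mpr].
- by move=> x; rewrite mule_ge0// lee_fin laplace_pdf_ge0.
apply: eq_integral => x _; rewrite addrK; congr (_ * _)%E.
Qed.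

End laplace_theory.

(** * Lower bound on the focused width *)

(** The integral of a nonnegative function is a supremum over the simple functions
    below it, so monotonicity does not require measurability.  The supremum of
    <X, u> over an uncountable family of vectors u is treated in this way. *)
Lemma ge0_le_integral_nonmeasurable d (T : measurableType d) (R : realType)
    (mu : {measure set T -> \bar R}) (f g : T -> \bar R) :
  (forall x, 0 <= f x)%E -> (forall x, f x <= g x)%E ->
  (\int[mu]_x f x <= \int[mu]_x g x)%E.
Proof.
move=> f0 fg; have g0 x : (0 <= g x)%E by exact: le_trans (f0 x) (fg x).
rewrite !ge0_integralTE//; apply: ge_ereal_sup => _ [h /= hf <-].
by apply: ereal_sup_ubound; exists h => // x; exact: le_trans (hf x) (fg x).
Qed.

Section orthants.
Context {R : realType}.
Local Notation P := (@laplace_prob R).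
Local Notation s := (Num.sqrt 2 : R).

Lemma dotp_voppr n (x u : n.-tuple R) : dotp x (vopp u) = - dotp x u.
Proof.
by rewrite /dotp -sumrN; apply: eq_bigr => i _; rewrite tnth_mktuple mulrN.
Qed.

Definition sign_tuple n (b : {ffun 'I_n -> bool}) : n.-tuple R :=
  [tuple (-1) ^+ b i | i < n].

(** A zero coordinate counts as positive, so that each point lies in exactly one
    orthant. *)
Definition orthant n (x : n.-tuple R) : {ffun 'I_n -> bool} :=
  [ffun i => tnth x i < 0].

(** The [j]-th factor of the function that is |x_i| on the orthant [b] and 0
    elsewhere. *)
Definition orthant_coord n (b : {ffun 'I_n -> bool}) (i j : 'I_n) (y : R) : R :=
  ((y < 0) == b j)%:R * (if j == i then `|y| else 1).

(** The choice of the vector by the signs of [x] is unfolded into products of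
    functions of one coordinate, which a product measure integrates factor by
    factor. *)
Lemma dotp_orthant n (u : {ffun 'I_n -> bool} -> n.-tuple R) (x : n.-tuple R) :
  dotp x (u (orthant x)) =
  \sum_b \sum_(i < n) tnth (sign_tuple b) i * tnth (u b) i *
    \prod_(j < n) orthant_coord b i j (tnth x j).
Proof.
have E b i : \prod_(j < n) orthant_coord b i j (tnth x j) =
    (b == orthant x)%:R * `|tnth x i|.
  rewrite big_split/= -big_mkcond/= big_pred1_eq; congr (_ * _).
  have [->|/eqP bx] := eqVneq b (orthant x).
    by rewrite big1// => j _; rewrite ffunE eqxx.
  have [j bj] : exists j, b j != orthant x j.
    apply/existsP; apply: contra_notT bx; rewrite negb_exists => /forallP bx.
    by apply/ffunP => j; apply/eqP; rewrite -[_ == _]negbK bx.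
  rewrite (bigD1 j)//= (_ : (_ == _) = false) ?mul0r//.
  by apply/negbTE; move: bj; rewrite ffunE eq_sym.
rewrite (bigD1 (orthant x))//= [X in _ + X]big1 ?addr0.
  apply: eq_bigr => i _; rewrite E eqxx mul1r tnth_mktuple ffunE mulrAC; congr (_ * _).
  by have [x0|x0] := ltP (tnth x i) 0; rewrite /= ?expr1 ?expr0 ?mulN1r ?mul1r
    ?(ltr0_norm x0) ?opprK// ger0_norm.
move=> b bx; rewrite big1// => i _.
by rewrite E (negbTE bx) mul0r mulr0.
Qed.

Lemma measurable_orthant_coord n b i j :
  measurable_fun [set: R] (@orthant_coord n b i j).
Proof.
apply: measurable_funM; first exact: measurable_indic_sign.
by case: (j == i).
Qed.

Lemma orthant_coord_ge0 n b i j y : 0 <= @orthant_coord n b i j y.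
Proof. by rewrite mulr_ge0//; case: ifP. Qed.

Lemma integral_orthant_coord n b i j :
  (\int[P]_y (@orthant_coord n b i j y)%:E =
   (2^-1 * (if j == i then s^-1 else 1))%:E)%E.
Proof.
rewrite /orthant_coord integral_laplace_half.
- case: (j == i); first by rewrite integral_laplace_norm_half invfM.
  under eq_integral do rewrite mul1r.
  by rewrite integral_laplace_pdf_half mulr1.
- by case: (j == i).
- by move=> y; case: ifP.
- by move=> y /=; rewrite normrN.
Qed.

Lemma integral_prod_orthant_coord n b i :
  (\int[product_probability P n]_x
     (\prod_(j < n) orthant_coord b i j (tnth x j))%:E = (s^-1 / 2 ^+ n)%:E)%E.
Proof.
rewrite integral_product_probability_prod; last 2 first.
- exact: measurable_orthant_coord.
- by move=> j x; exact: orthant_coord_ge0.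
under eq_bigr do rewrite integral_orthant_coord.
rewrite prodEFin big_split/= -big_mkcond/= big_pred1_eq prodr_const card_ord.
by rewrite exprVn mulrC.
Qed.

Lemma measurable_prod_orthant_coord n b i :
  measurable_fun [set: n.-tuple R]
    (fun x : n.-tuple R => \prod_(j < n) orthant_coord b i j (tnth x j)).
Proof.
exact: (measurable_prod_tnth (fun j => @measurable_orthant_coord n b i j)).
Qed.

Lemma integrable_prod_orthant_coord n b i :
  (product_probability P n).-integrable [set: n.-tuple R]
    (fun x => (\prod_(j < n) orthant_coord b i j (tnth x j))%:E).
Proof.
apply/integrableP; split.
  by apply/measurable_EFinP; exact: measurable_prod_orthant_coord.
under eq_integral => x _.
  rewrite gee0_abs; last by rewrite lee_fin prodr_ge0// => j _; exact: orthant_coord_ge0.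
  over.
by rewrite integral_prod_orthant_coord ltry.
Qed.

Lemma measurable_dotp_orthant n (u : {ffun 'I_n -> bool} -> n.-tuple R) :
  measurable_fun [set: n.-tuple R] (fun x => dotp x (u (orthant x))).
Proof.
under eq_fun do rewrite dotp_orthant.
apply: measurable_sum => b; apply: measurable_sum => i.
by apply: measurable_funM => //; exact: measurable_prod_orthant_coord.
Qed.

(** Each orthant has probability 2^(-n), and given the orthant [b] the mean of the
    vector is [sign_tuple b] / s. *)
Lemma integral_dotp_orthant n (u : {ffun 'I_n -> bool} -> n.-tuple R) :
  (\int[product_probability P n]_x (dotp x (u (orthant x)))%:E =
   (s^-1 / 2 ^+ n * \sum_b dotp (sign_tuple b) (u b))%:E)%E.
Proof.
under eq_integral do rewrite dotp_orthant -sumEFin.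
rewrite integral_sum//; last first.
  move=> b; under eq_fun do rewrite -sumEFin; apply: integrable_sum => // i _.
  under eq_fun do rewrite EFinM; apply: integrableZl => //.
  exact: integrable_prod_orthant_coord.
rewrite mulr_sumr -sumEFin; apply: eq_bigr => b _.
under eq_integral do rewrite -sumEFin.
rewrite integral_sum//; last first.
  move=> i; under eq_fun do rewrite EFinM; apply: integrableZl => //.
  exact: integrable_prod_orthant_coord.
rewrite mulr_sumr -sumEFin; apply: eq_bigr => i _.
under eq_integral do rewrite EFinM.
rewrite integralZl//; last exact: integrable_prod_orthant_coord.
by rewrite integral_prod_orthant_coord -EFinM mulrC.
Qed.

End orthants.

Section width_lower_bound.
Context {R : realType} {n : nat} d (Omega : measurableType d)
  (P : probability Omega R) (X : {RV P >-> n.-tuple R}).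
Local Notation s := (Num.sqrt 2 : R).
Local Notation Q := (product_probability (@laplace_prob R) n).
Hypothesis XQ : has_law X Q.

(** The supremum over [S] dominates the dot product with the vector of [S] chosen by
    the signs of [X], and it is nonnegative because [S] is symmetric; hence it
    dominates the positive part of that dot product. *)
Lemma width_ge (S : set (n.-tuple R)) : origin_symmetric S ->
  (forall t, sign_vectors t -> exists2 u, S u & 1 <= dotp t u) ->
  ((s^-1)%:E <= width X S)%E.
Proof.
move=> symS S1.
have sgn b : sign_vectors (@sign_tuple R n b).
  move=> i; rewrite tnth_mktuple.
  by case: (b i); [left; rewrite expr1|right; rewrite expr0].
have [u Su] : {u : {ffun 'I_n -> bool} -> n.-tuple R &
    forall b, S (u b) /\ 1 <= dotp (sign_tuple b) (u b)}.
  apply: (choice (P := fun (b : {ffun 'I_n -> bool}) u =>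
    S u /\ 1 <= dotp (sign_tuple b) u)) => b.
  by have [u] := S1 _ (sgn b); exists u.
pose g (x : n.-tuple R) : \bar R := (dotp x (u (orthant x)))%:E.
have mg : measurable_fun [set: n.-tuple R] g.
  by apply/measurable_EFinP; exact: measurable_dotp_orthant.
apply: (@le_trans _ _ (\int[P]_w (g^\+%E \o X) w)%E); last first.
  apply: ge0_le_integral_nonmeasurable => w; first exact: funepos_ge0.
  rewrite /= funeposE ge_max; apply/andP; split.
    apply: ereal_sup_ubound; exists (u (orthant (X w))) => //.
    by have [] := Su (orthant (X w)).
  have [v Sv] : exists v, S v.
    by exists (u (orthant (X w))); have [] := Su (orthant (X w)).
  have [v0|v0] := leP 0 (dotp (X w) v).
    by apply: le_ereal_sup_tmp; exists (dotp (X w) v)%:E => //; exists v.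
  apply: le_ereal_sup_tmp; exists (dotp (X w) (vopp v))%:E.
    by exists (vopp v) => //; rewrite symS; exists v.
  by rewrite dotp_voppr lee_fin oppr_ge0 ltW.
rewrite -ge0_integral_distribution; [|exact: measurable_funepos|by []].
rewrite (eq_measure_integral Q); last by move=> A mA _; exact: XQ.
apply: (@le_trans _ _ (\int[Q]_x g x)%E); last first.
  rewrite [leLHS]integralE -[leRHS]sube0 leeB//.
  by apply: integral_ge0 => x _; exact: funeneg_ge0.
rewrite integral_dotp_orthant lee_fin -mulrA ler_peMr ?invr_ge0//.
rewrite mulrC ler_pdivlMr ?exprn_gt0// mul1r.
apply: (@le_trans _ _ (\sum_(b : {ffun 'I_n -> bool}) 1)).
  by rewrite sumr_const card_ffun card_bool card_ord natrX.
by apply: ler_sum => b _; have [] := Su b.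
Qed.

Lemma focused_width_ge (T : set (n.-tuple R)) :
  sign_vectors `<=` T -> ((s^-1)%:E <= focused_width X T)%E.
Proof.
move=> sT; apply: le_ereal_inf_tmp => _ [S [symS TS] <-].
by apply: width_ge => // t /sT /TS.
Qed.

End width_lower_bound.

(** * The periodic test *)

Section periodic_test.
Context {R : realType}.
Local Notation P := (@laplace_prob R).

Lemma cosB_odd (z : R) (k : int) : cos (z - pi * (2 * k + 1)%:~R) = - cos z.
Proof.
have cos2 (m : nat) y : cos (y + pi * (2 * m%:R)) = cos y :> R.
  rewrite -[RHS](periodicn (@cosD2pi R) m); congr cos; congr (_ + _).
  by rewrite -mulrnA -[RHS]mulr_natr natrM.
rewrite rmorphD rmorphM/= mulrDr mulr1.
case: k => m.
  rewrite -[RHS]cosDpi -[LHS](cos2 m.+1) -!pmulrn -natr1; congr cos; ring.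
rewrite NegzE -[RHS]cosDpi -[RHS](cos2 m) mulrNz -!pmulrn -natr1; congr cos; ring.
Qed.

Definition cos_sum n (a : R) (x : n.-tuple R) : R := \sum_(i < n) cos (a * tnth x i).

Lemma measurable_cos_sum n a : measurable_fun [set: n.-tuple R] (@cos_sum n a).
Proof.
apply: measurable_sum => i.
apply: (measurableT_comp (f := fun y : R => cos (a * y))); last exact: measurable_tnth.
apply: continuous_measurable_fun => y; apply: continuous_comp; last exact: continuous_cos.
by apply: cvgMl_tmp; exact: cvg_id.
Qed.

(** Oddness of the coordinates of T gives the inclusion from left to right.  The
    all-ones vector alone gives the converse, which makes the difference set
    measurable. *)
Lemma minkowski_sub_cos_sum n (r : R) (T : set (n.-tuple R)) : 0 < r ->
  sign_vectors `<=` T -> T `<=` odd_vectors ->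
  minkowski_sub [set x | 0 <= cos_sum (pi / r) x] r T =
  [set x | cos_sum (pi / r) x <= 0].
Proof.
move=> r0 sT To; have rn0 : r != 0 by rewrite gt_eqF.
have cosE (x t : n.-tuple R) : odd_vectors t ->
    cos_sum (pi / r) [tuple tnth x i - r * tnth t i | i < n] = - cos_sum (pi / r) x.
  move=> ot; rewrite /cos_sum -sumrN; apply: eq_bigr => i _.
  rewrite tnth_mktuple; have [k ->] := ot i; rewrite -(cosB_odd _ k); congr cos.
  by field.
apply/seteqP; split => [_ [x /= x0] [t Tt] <-|y /= y0].
  by rewrite cosE ?oppr_le0//; exact: To.
pose t : n.-tuple R := [tuple 1 | i < n].
have Tt : T t by apply: sT => i; right; rewrite tnth_mktuple.
exists [tuple tnth y i - r * - 1 | i < n].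
  rewrite /= (_ : cos_sum _ _ = - cos_sum (pi / r) y) ?oppr_ge0//.
  rewrite -(cosE _ (vopp t)).
    by congr cos_sum; apply: eq_from_tnth => i; rewrite !tnth_mktuple.
  by move=> i; exists (-1); rewrite !tnth_mktuple.
exists t => //; apply: eq_from_tnth => i; rewrite !tnth_mktuple.
by rewrite mulrN opprK mulr1 addrK.
Qed.

(** By 1 + x <= exp(x) it suffices that (1 + x)(1 - x + 2 x^2) = 1 + x^2 (1 + 2 x)
    is at least 1. *)
Lemma expRN_le (x : R) : - 2^-1 <= x -> expR (- x) <= 1 - x + 2 * x ^+ 2.
Proof.
move=> x2; have x1 : 0 < 1 + x by lra.
rewrite expRN; apply: (@le_trans _ _ (1 + x)^-1).
  by rewrite lef_pV2 ?posrE ?expR_gt0// expR_ge1Dx.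
rewrite -[leLHS]mul1r ler_pdivrMr//; nra.
Qed.

Lemma expRN4_le : expR (-4) <= 1 / 10 :> R.
Proof.
have e1 : (2 : R) <= expR 1 by have := expR_ge1Dx (1 : R); lra.
have e4 : (2 : R) ^+ 4 <= expR 4.
  rewrite (_ : expR 4 = expR 1 ^+ 4); last by rewrite -expRM_natl mulr1.
  by rewrite lerXn2r ?nnegrE ?expR_ge0.
rewrite expRN mul1r lef_pV2 ?posrE ?expR_gt0//; apply: le_trans e4; lra.
Qed.

Lemma continuous_expR_cos (a l : R) :
  continuous (fun x : R => expR (- (l * cos (a * x)))).
Proof.
move=> x; apply: continuous_comp; last exact: continuous_expR.
apply: cvgN; apply: cvgMl_tmp; apply: continuous_comp; last exact: continuous_cos.
by apply: cvgMl_tmp; exact: cvg_id.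
Qed.

Lemma integral_laplace_expR_cos (a l : R) : 0 <= l <= 2^-1 ->
  (\int[P]_x (expR (- (l * cos (a * x))))%:E <=
   (1 - l * (2 / (a ^+ 2 + 2)) + 2 * l ^+ 2)%:E)%E.
Proof.
move=> /andP[l0 l2].
have mE : measurable_fun [set: R] (fun x : R => (expR (- (l * cos (a * x))))%:E).
  by apply/measurable_EFinP; apply: continuous_measurable_fun; exact: continuous_expR_cos.
have mC : measurable_fun [set: R] (fun x : R => (1 + cos (a * x))%:E).
  apply/measurable_EFinP; apply: continuous_measurable_fun => x.
  apply: cvgD; first exact: cvg_cst.
  apply: continuous_comp; last exact: continuous_cos.
  by apply: cvgMl_tmp; exact: cvg_id.
have C0 (x : R) : 0 <= 1 + cos (a * x) by have := cos_geN1 (a * x); lra.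
(* adding l (1 + cos (a x)) to both sides leaves only nonnegative integrands *)
rewrite (_ : 1 - _ + _ = (1 + l + 2 * l ^+ 2) - l * (1 + 2 / (a ^+ 2 + 2))); last by ring.
rewrite EFinB leeBrDr// EFinM -integral_laplace_cos -ge0_integralZl_EFin//.
rewrite -ge0_integralD//; last 2 first.
- by move=> x _; rewrite mule_ge0// lee_fin.
- exact: emeasurable_funM.
have -> : (1 + l + 2 * l ^+ 2)%:E = (\int[P]_x (1 + l + 2 * l ^+ 2)%:E)%E.
  by rewrite integral_cst// [X in (_ * X)%E]probability_setT mule1.
apply: ge0_le_integral => //.
- by move=> x _; rewrite adde_ge0// ?mule_ge0// lee_fin ?expR_ge0.
- by apply: emeasurable_funD => //; exact: emeasurable_funM.
move=> x _; rewrite -EFinM -EFinD lee_fin.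
have := cos_geN1 (a * x); have := cos_le1 (a * x); set c := cos _ => c1 cN1.
have lc : - 2^-1 <= l * c by nra.
have : (l * c) ^+ 2 <= l ^+ 2 by rewrite exprMn ler_piMr ?sqr_ge0//; nra.
have := expRN_le lc; lra.
Qed.

(** Chernoff's bound: where the sum of cosines is at most 0, the product of the
    factors exp(- l cos(a x_i)) is at least 1, and each factor has mean at most
    1 - l d + 2 l^2. *)
Lemma laplace_cos_sum_tail n (a : R) (d := 2 / (a ^+ 2 + 2)) :
  (product_probability P n [set x | (cos_sum a x <= 0)%R] <=
   (expR (- (n%:R * d ^+ 2 / 8)))%:E)%E.
Proof.
have D0 : 0 < a ^+ 2 + 2 by rewrite ltr_wpDl// sqr_ge0.
have d0 : 0 <= d by rewrite divr_ge0// ltW.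
have d1 : d <= 1 by rewrite ler_pdivrMr// mul1r lerDr sqr_ge0.
(* the minimizer of 1 - l d + 2 l^2, with minimum 1 - d^2 / 8 *)
pose l := d / 4.
have mB : measurable [set x : n.-tuple R | cos_sum a x <= 0].
  rewrite -[X in measurable X]setTI; apply: measurable_fun_le => //.
  exact: measurable_cos_sum.
have me : measurable_fun [set: R] (fun x => expR (- (l * cos (a * x)))).
  by apply: continuous_measurable_fun; exact: continuous_expR_cos.
rewrite -[X in product_probability P n X]setIT -integral_indic//.
apply: (@le_trans _ _ (\int[product_probability P n]_x
  (\prod_(i < n) expR (- (l * cos (a * tnth x i))))%:E)%E).
  apply: ge0_le_integral => //.
  - exact/measurable_EFinP.
  - apply/measurable_EFinP.
    exact: (measurable_prod_tnth (f := fun _ x => expR (- (l * cos (a * x))))).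
  move=> x _; rewrite lee_fin -expR_sum indicE.
  case: (boolP (x \in _)) => [|_]; last exact: expR_ge0.
  rewrite inE/= => x0; rewrite -[X in X <= _]expR0 ler_expR sumrN -mulr_sumr.
  by rewrite oppr_ge0 mulr_ge0_le0// divr_ge0.
rewrite (@integral_product_probability_prod _ _ _ _ n
  (fun _ x => expR (- (l * cos (a * x)))))//.
have l0 : 0 <= l <= 2^-1 by rewrite /l; lra.
have := integral_laplace_expR_cos a l0; rewrite -/d.
have : (0 <= \int[P]_x (expR (- (l * cos (a * x))))%:E)%E.
  by apply: integral_ge0 => x _; rewrite lee_fin expR_ge0.
case: (\int[P]_x _)%E => [I| |//]; last by rewrite leye_eq.
rewrite !lee_fin => I0 Il.
rewrite prodEFin prodr_const card_ord lee_fin -mulrA -mulrN expRM_natl.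
rewrite lerXn2r ?nnegrE ?expR_ge0//; apply: (le_trans Il).
apply: le_trans (expR_ge1Dx _); rewrite /l; lra.
Qed.

End periodic_test.

(** * Bounds on the detectability radius *)

(** The union of the translates of A is indexed by the integer vectors, which are
    countable, instead of by [T]. *)
Lemma measurable_minkowski_sub (R : realType) n (A : set (n.-tuple R)) (r : R)
    (T : set (n.-tuple R)) :
  T `<=` odd_vectors -> measurable A -> measurable (minkowski_sub A r T).
Proof.
move=> To mA; pose odd_tuple (k : n.-tuple int) : n.-tuple R :=
  [tuple (2 * tnth k i + 1)%:~R | i < n].
pose shift (k : n.-tuple int) (y : n.-tuple R) : n.-tuple R :=
  [tuple tnth y i + r * tnth (odd_tuple k) i | i < n].
rewrite (_ : minkowski_sub _ _ _ = \bigcup_(k in [set: n.-tuple int])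
   (if `[< T (odd_tuple k) >] then shift k @^-1` A else set0)).
  apply: countable_bigcupT_measurable => [|k]; first exact: countableP.
  case: ifP => _ //; rewrite -[X in measurable X]setTI.
  suff : measurable_fun [set: n.-tuple R] (shift k) by exact.
  apply/measurable_fun_tnthP => i.
  rewrite (_ : _ \o _ = fun y => tnth y i + r * tnth (odd_tuple k) i).
    by apply: measurable_funD => //; exact: measurable_tnth.
  by apply/funext => y /=; rewrite tnth_mktuple.
apply/seteqP; split => [_ [x Ax] [t Tt] <-|y [k _]].
  have [k kt] := choice (To t Tt).
  exists [tuple k i | i < n] => //.
  have -> : odd_tuple [tuple k i | i < n] = t.
    by apply: eq_from_tnth => i; rewrite !tnth_mktuple kt.
  rewrite asboolT//= (_ : shift _ _ = x)//.
  by apply: eq_from_tnth => i; rewrite !tnth_mktuple kt subrK.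
case: asboolP => //= Tk Ak; exists (shift k y) => //; exists (odd_tuple k) => //.
by apply: eq_from_tnth => i; rewrite !tnth_mktuple addrK.
Qed.

Section radius.
Context {R : realType} {n : nat} d (Omega : measurableType d)
  (P : probability Omega R) (X : {RV P >-> n.-tuple R}).
Local Notation s := (Num.sqrt 2 : R).
Local Notation Q := (product_probability (@laplace_prob R) n).
Hypothesis XQ : has_law X Q.

(** Both error probabilities of the test are at most exp(- n d^2 / 8) <= exp(- 4),
    where d = 2 / (a^2 + 2) and a = pi / r. *)
Lemma detectable (r : R) (T : set (n.-tuple R)) : 0 < r ->
  sign_vectors `<=` T -> T `<=` odd_vectors ->
  32 <= n%:R * (2 / ((pi / r) ^+ 2 + 2)) ^+ 2 ->
  exists A : set (n.-tuple R),
    [/\ measurable A, ((9 / 10)%:E <= P (X @^-1` A))%E &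
        (P (X @^-1` minkowski_sub A r T) <= (1 / 10)%:E)%E].
Proof.
move=> r0 sT To n32; have mc := @measurable_cos_sum R n (pi / r).
have mB : measurable [set x : n.-tuple R | cos_sum (pi / r) x <= 0].
  rewrite -[X in measurable X]setTI; exact: measurable_fun_le.
pose A := [set x : n.-tuple R | 0 <= cos_sum (pi / r) x].
have mA : measurable A.
  rewrite -[X in measurable X]setTI; exact: measurable_fun_le.
have QB : (Q [set x | (cos_sum (pi / r) x <= 0)%R] <= (1 / 10)%:E)%E.
  apply: (le_trans (laplace_cos_sum_tail _ _)); rewrite lee_fin.
  by apply: le_trans expRN4_le; rewrite ler_expR lerN2; lra.
exists A; split => //.
- rewrite -[leRHS]/(distribution P X _) XQ//.
  have mAC := measurableC mA.
  have -> : Q A = (1 - Q (~` A))%E by rewrite -probability_setC// setCK.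
  have : (Q (~` A) <= (1 / 10)%:E)%E.
    apply: le_trans QB; apply: le_measure; rewrite ?inE//.
    by move=> x; rewrite /A/=; case: (leP 0 (cos_sum (pi / r) x)) => // /ltW.
  rewrite -[Q _]fineK ?fin_num_measure// -EFinB !lee_fin; lra.
- by rewrite minkowski_sub_cos_sum// -[leLHS]/(distribution P X _) XQ.
Qed.

(** Put q = n^(1/4).  If r > 16 / q, then a = pi / r satisfies a^2 <= q^2 / 16, and
    since q^2 >= 8 this gives n^(1/2) d = 2 q^2 / (a^2 + 2) >= 6. *)
Lemma detectability_radius_le (T : set (n.-tuple R)) : (64 <= n)%N ->
  sign_vectors `<=` T -> T `<=` odd_vectors ->
  (detectability_radius X T <= (16 / n%:R `^ 4^-1)%:E)%E.
Proof.
move=> n64 sT To; apply: ge_ereal_sup => _ [r [r0 nA] <-]; rewrite lee_fin.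
rewrite leNgt; apply/negP => qr; apply: nA; apply: detectable => //.
set q : R := n%:R `^ 4^-1 in qr *.
have n0 : (0 : R) < n%:R by rewrite ltr0n (leq_trans _ n64).
have q0 : 0 < q by rewrite powR_gt0.
have q4 : q ^+ 2 ^+ 2 = n%:R.
  by rewrite -exprM -powR_mulrn ?ltW// -powRrM mulVf// powRr1// ltW.
have t8 : 8 <= q ^+ 2.
  rewrite -ler_sqr ?nnegrE ?sqr_ge0// q4 -natrX ler_nat; exact: n64.
rewrite -q4 -exprMn.
have a2 : (pi / r) ^+ 2 <= q ^+ 2 / 16.
  have pi4 : pi <= 4 :> R by have := @pihalf_lt2 R; lra.
  have -> : q ^+ 2 / 16 = (q / 4) ^+ 2 by field.
  rewrite lerXn2r ?nnegrE ?divr_ge0 ?pi_ge0 ?ltW//.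
  rewrite ltr_pdivrMr//; move: qr; rewrite ltr_pdivrMr// => qr; nra.
set a := (pi / r) ^+ 2 in a2 *; set t := q ^+ 2 in t8 a2 *.
have a0 : 0 <= a by rewrite sqr_ge0.
apply: (@le_trans _ _ (6 ^+ 2)); first by lra.
rewrite lerXn2r ?nnegrE ?mulr_ge0 ?invr_ge0//; try lra.
by rewrite mulrA ler_pdivlMr; lra.
Qed.

(** Since T contains the all-ones vector, A - rT contains the translate of A by
    (-r, ..., -r).  For r = 1 / (2 s n) the translation keeps at least the fraction
    exp(- 1/2) >= 1/2 of the probability, and 9/20 > 1/10. *)
Lemma detectability_radius_gt0 (T : set (n.-tuple R)) : (0 < n)%N ->
  sign_vectors `<=` T -> T `<=` odd_vectors -> (0 < detectability_radius X T)%E.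
Proof.
move=> n0 sT To; have s0 := @sqrt2_gt0 R.
have n0' : (0 : R) < n%:R by rewrite ltr0n.
pose r : R := (2 * s * n%:R)^-1.
have r0 : 0 < r by rewrite invr_gt0 !mulr_gt0.
apply: (@lt_le_trans _ _ r%:E); first by rewrite lte_fin.
apply: ereal_sup_ubound; exists r => //; split => // -[A [mA PA PAr]].
move: PAr; apply/negP; rewrite -ltNge.
move: PA; rewrite -[P _]/(distribution P X _) XQ// => QA.
rewrite -[P _]/(distribution P X _) XQ; last exact: measurable_minkowski_sub.
have k0 := expR_ge0 (- (s * r)).
have mphi : measurable_fun [set: R] (fun x : R => x + r) by exact: measurable_funD.
have := @product_probability_map_ge _ _ _ _ n _ _ k0 mphi
  (fun B => @laplace_shift_ge R r B (ltW r0)) A mA.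
rewrite -expRM_natl => QAr.
apply: (@lt_le_trans _ _ (Q (map_tuple (fun x => x + r) @^-1` A))).
  apply: lt_le_trans QAr.
  apply: (@lt_le_trans _ _ ((2^-1)%:E * (9 / 10)%:E)%E).
    by rewrite -EFinM lte_fin; lra.
  apply: lee_pmul; [by rewrite lee_fin|by rewrite lee_fin; lra| |exact: QA].
  rewrite lee_fin; apply: le_trans (expR_ge1Dx _).
  rewrite (_ : n%:R * - (s * r) = - 2^-1); first by lra.
  rewrite /r; field; rewrite !gt_eqF//.
apply: le_measure; rewrite ?inE.
- rewrite -[X in measurable X]setTI.
  suff : measurable_fun [set: n.-tuple R]
    (map_tuple (n := n) (fun x : R => x + r)) by exact.
  exact: measurable_map_tuple.
- exact: measurable_minkowski_sub.
move=> y /= Ay; exists (map_tuple (fun x => x + r) y) => //.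
exists [tuple 1 | i < n]; first by apply: sT => i; right; rewrite tnth_mktuple.
by apply: eq_from_tnth => i; rewrite !tnth_mktuple tnth_map mulr1 addrK.
Qed.

End radius.

(** * The width-to-radius ratio *)

Theorem corollary1 (R : realType) :
  exists (c : R) (n0 : nat), 0 < c /\
    forall (n : nat) (T : set (n.-tuple R)),
      (n0 <= n)%N ->
      origin_symmetric T ->
      sign_vectors `<=` T ->
      T `<=` odd_vectors ->
      forall (d : measure_display) (Omega : measurableType d)
        (P : probability Omega R) (X : {RV P >-> n.-tuple R}),
        has_law X (product_probability laplace_prob n) ->
        ((c * n%:R `^ 4^-1)%:E <=
           focused_width X T / detectability_radius X T)%E.
Proof.
have s0 := @sqrt2_gt0 R.
exists ((Num.sqrt 2)^-1 / 16), 64%N; split; first by rewrite divr_gt0 ?invr_gt0.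
move=> n T n64 _ sT To d Omega P X XQ.
have n0 : (0 < n)%N by exact: leq_trans n64.
have q0 : 0 < n%:R `^ 4^-1 :> R by apply: powR_gt0; rewrite ltr0n.
have rpos := detectability_radius_gt0 XQ n0 sT To.
have rle := detectability_radius_le XQ n64 sT To.
rewrite -mulrA EFinM; apply: lee_pmul.
- by rewrite lee_fin invr_ge0 ltW.
- by rewrite lee_fin mulr_ge0// ltW.
- exact: focused_width_ge.
rewrite (_ : (16^-1 * _)%:E = ((16 / n%:R `^ 4^-1)%:E)^-1%E).
  by rewrite lee_pV2// inE/= ?lee_fin ?divr_ge0 ?ltW.
by rewrite inver gt_eqF ?divr_gt0// invfM invrK.
Qed.
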